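(* Let $\alpha\in(0,2\pi)$ and $\rho\in\mathbb C$, and let $$S=\begin{pmatrix}\cos\frac{\alpha}{2} & ie^{\rho/2}\sin\frac{\alpha}{2}\\ ie^{-\rho/2}\sin\frac{\alpha}{2} & \cos\frac{\alpha}{2}\end{pmatrix},\qquad T=\begin{pmatrix}\cos\frac{\alpha}{2} & ie^{-\rho/2}\sin\frac{\alpha}{2}\\ ie^{\rho/2}\sin\frac{\alpha}{2} & \cos\frac{\alpha}{2}\end{pmatrix}.$$ Put $A=\cot\frac{\alpha}{2}$, $V=\cosh\rho$ and $W=S^{-1}(STS^{-1}T^{-1})^2(ST^{-1}S^{-1}T)^2$. If $P(V,A)=0$, where $$P(V,A)=8V^5+8A^2V^4+(8A^4+16A^2-8)V^3+(4A^6+8A^4-12A^2)V^2+(A^8+4A^6-2A^4-12A^2+1)V-4A^6-8A^4+4A^2,$$ then $SWS^{-1}W^{-1}=I$, i.e. $s\mapsto S$, $t\mapsto T$ defines a representation $h$ of $\pi_1(X)=\langle s,t\mid sws^{-1}w^{-1}=1\rangle$, $w=s^{-1}[s,t]^2[s,t^{-1}]^2$, into $\mathrm{SL}(2,\mathbb C)$.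
   Context: $X$ is the complement of the link $7_3^2$ (slope $9/16$ version), with fundamental group $\pi_1(X)=\langle s,t\mid sws^{-1}w^{-1}=1\rangle$, $w=s^{-1}[s,t]^2[s,t^{-1}]^2$, and commutator convention $[a,b]=aba^{-1}b^{-1}$. The polynomial $P$ is called the Riley–Mednykh polynomial of the link $7_3^2$. *)

(* Defs.v *)
From Stdlib Require Import Reals.
Open Scope R_scope.

Record Cplx := mkC { Re : R ; Im : R }.

Definition RtoC (x : R) : Cplx := mkC x 0.
Definition C0 : Cplx := RtoC 0.
Definition C1 : Cplx := RtoC 1.
Definition Ci : Cplx := mkC 0 1.
Definition Cadd (z w : Cplx) : Cplx := mkC (Re z + Re w) (Im z + Im w).
Definition Copp (z : Cplx) : Cplx := mkC (- Re z) (- Im z).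
Definition Csub (z w : Cplx) : Cplx := Cadd z (Copp w).
Definition Cmul (z w : Cplx) : Cplx :=
  mkC (Re z * Re w - Im z * Im w) (Re z * Im w + Im z * Re w).
Definition Cinv (z : Cplx) : Cplx :=
  let n := Re z * Re z + Im z * Im z in mkC (Re z / n) (- Im z / n).
Fixpoint Cpow (z : Cplx) (n : nat) : Cplx :=
  match n with O => C1 | S k => Cmul z (Cpow z k) end.

Definition Cexp (z : Cplx) : Cplx := mkC (exp (Re z) * cos (Im z)) (exp (Re z) * sin (Im z)).
Definition Ccosh (z : Cplx) : Cplx := Cmul (RtoC (/2)) (Cadd (Cexp z) (Cexp (Copp z))).

Record Mat2 := mkM { m11 : Cplx ; m12 : Cplx ; m21 : Cplx ; m22 : Cplx }.
Definition MI : Mat2 := mkM C1 C0 C0 C1.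
Definition Mmul (X Y : Mat2) : Mat2 :=
  mkM (Cadd (Cmul (m11 X) (m11 Y)) (Cmul (m12 X) (m21 Y)))
      (Cadd (Cmul (m11 X) (m12 Y)) (Cmul (m12 X) (m22 Y)))
      (Cadd (Cmul (m21 X) (m11 Y)) (Cmul (m22 X) (m21 Y)))
      (Cadd (Cmul (m21 X) (m12 Y)) (Cmul (m22 X) (m22 Y))).
Definition Mdet (X : Mat2) : Cplx := Csub (Cmul (m11 X) (m22 X)) (Cmul (m12 X) (m21 X)).
Definition Minv (X : Mat2) : Mat2 :=
  let k := Cinv (Mdet X) in
  mkM (Cmul k (m22 X)) (Cmul k (Copp (m12 X))) (Cmul k (Copp (m21 X))) (Cmul k (m11 X)).

Definition Smat (alpha : R) (rho : Cplx) : Mat2 :=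
  let c := RtoC (cos (alpha / 2)) in
  let s := RtoC (sin (alpha / 2)) in
  let h := Cmul (RtoC (/2)) rho in
  mkM c (Cmul Ci (Cmul (Cexp h) s)) (Cmul Ci (Cmul (Cexp (Copp h)) s)) c.
Definition Tmat (alpha : R) (rho : Cplx) : Mat2 :=
  let c := RtoC (cos (alpha / 2)) in
  let s := RtoC (sin (alpha / 2)) in
  let h := Cmul (RtoC (/2)) rho in
  mkM c (Cmul Ci (Cmul (Cexp (Copp h)) s)) (Cmul Ci (Cmul (Cexp h) s)) c.

Definition Wmat (S T : Mat2) : Mat2 :=
  let Si := Minv S in let Ti := Minv T in
  let c1 := Mmul S (Mmul T (Mmul Si Ti)) in
  let c2 := Mmul S (Mmul Ti (Mmul Si T)) in
  Mmul Si (Mmul (Mmul c1 c1) (Mmul c2 c2)).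

(** Riley–Mednykh polynomial P(V,A) of the link 7_3^2, V complex, A real. *)
Definition RMpoly (V : Cplx) (A : R) : Cplx :=
  let a := RtoC A in
  let cst (x : R) := RtoC x in
  Cadd (Cmul (cst 8) (Cpow V 5))
  (Cadd (Cmul (Cmul (cst 8) (Cpow a 2)) (Cpow V 4))
  (Cadd (Cmul (Cadd (Cadd (Cmul (cst 8) (Cpow a 4)) (Cmul (cst 16) (Cpow a 2))) (cst (-8))) (Cpow V 3))
  (Cadd (Cmul (Cadd (Cadd (Cmul (cst 4) (Cpow a 6)) (Cmul (cst 8) (Cpow a 4))) (Cmul (cst (-12)) (Cpow a 2))) (Cpow V 2))
  (Cadd (Cmul (Cadd (Cadd (Cadd (Cadd (Cpow a 8) (Cmul (cst 4) (Cpow a 6))) (Cmul (cst (-2)) (Cpow a 4)))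
                        (Cmul (cst (-12)) (Cpow a 2))) (cst 1)) V)
  (Cadd (Cmul (cst (-4)) (Cpow a 6)) (Cadd (Cmul (cst (-8)) (Cpow a 4)) (Cmul (cst 4) (Cpow a 2)))))))).

(* Main.v *)
Require Import Defs.
From Stdlib Require Import Reals.
From Stdlib Require Import ZArith Ring Lra.
(* [Reals] shadows the [C1] of [Defs]. *)
Import Defs.
Open Scope R_scope.

(** Since [S = [[c, p], [q, c]]] has determinant 1, it commutes with
    [W = S^-1 U], [U = [S,T]^2 [S,T^-1]^2], iff [U11 = U22] and
    [q U12 = p U21].  Writing [p = i e^(rho/2) s], [q = i e^(-rho/2) s] and
    replacing inverses by adjugates, [U11 - U22] and [q U12 - p U21] are
    homogeneous polynomials in [c, p, q] of degrees 16 and 17.  Both are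
    multiples of the homogenization (of degree 10, obtained by putting
    [A = c / s], [s^2 = - p q], [2 s^2 V = - (p^2 + q^2)]) of the
    Riley–Mednykh polynomial. *)

Declare Scope Cplx_scope.
Delimit Scope Cplx_scope with Cx.
Bind Scope Cplx_scope with Cplx.
Local Infix "+" := Cadd : Cplx_scope.
Local Infix "-" := Csub : Cplx_scope.
Local Infix "*" := Cmul : Cplx_scope.
Local Infix "^" := Cpow : Cplx_scope.
Local Notation "- z" := (Copp z) : Cplx_scope.
Local Notation "# x" := (RtoC x%R) (at level 1, format "# x") : Cplx_scope.

Lemma Cplx_ext (z w : Cplx) : Re z = Re w -> Im z = Im w -> z = w.
Proof. destruct z, w; simpl; intros -> ->; reflexivity. Qed.

Lemma Cplx_ring_theory : ring_theory C0 C1 Cadd Cmul Csub Copp eq.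
Proof.
  constructor; intros; try reflexivity; apply Cplx_ext; simpl; ring.
Qed.

Lemma RtoC_IZR_morph :
  ring_morph C0 C1 Cadd Cmul Csub Copp eq
    0%Z 1%Z Z.add Z.mul Z.sub Z.opp Z.eqb (fun z => RtoC (IZR z)).
Proof.
  constructor; try reflexivity; intros x y || intros x.
  - apply Cplx_ext; simpl; rewrite ?plus_IZR; ring.
  - apply Cplx_ext; simpl; rewrite ?minus_IZR; ring.
  - apply Cplx_ext; simpl; rewrite ?mult_IZR; ring.
  - apply Cplx_ext; simpl; rewrite ?opp_IZR; ring.
  - intros H; apply Z.eqb_eq in H; subst; reflexivity.
Qed.

Lemma Cpow_power_theory : power_theory C1 Cmul eq N.to_nat Cpow.
Proof.
  constructor; intros z n; destruct n as [|n]; [reflexivity|]; simpl.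
  (* [pow_pos] recurses on binary digits and [Cpow] on a unary exponent; Peano induction reconciles
     them. *)
  induction n using Pos.peano_ind.
  - apply Cplx_ext; simpl; ring.
  - rewrite Pos2Nat.inj_succ, pow_pos_succ; simpl.
    + now rewrite IHn.
    + repeat constructor; congruence.
    + now intros ? ? -> ? ? ->.
    + apply (Rmul_assoc Cplx_ring_theory).
Qed.

Ltac Cplx_cst t :=
  match t with
  | C0 => constr:(0%Z)
  | C1 => constr:(1%Z)
  | RtoC (IZR ?z) =>
      match isZcst z with true => z | _ => constr:(NotConstant) end
  | _ => constr:(NotConstant)
  end.

Ltac Cpow_cst t :=
  match isnatcst t with
  | true => constr:(N.of_nat t)
  | _ => constr:(InitialRing.NotConstant)
  end.

Add Ring Cplx_ring : Cplx_ring_theory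
  (morphism RtoC_IZR_morph, constants [Cplx_cst],
   power_tac Cpow_power_theory [Cpow_cst]).

Lemma Cexp_add (z w : Cplx) : Cexp (z + w)%Cx = (Cexp z * Cexp w)%Cx.
Proof.
  apply Cplx_ext; simpl; rewrite exp_plus, ?cos_plus, ?sin_plus; ring.
Qed.

Lemma Cexp_oppr (z : Cplx) : (Cexp z * Cexp (- z))%Cx = C1.
Proof.
  rewrite <- Cexp_add; apply Cplx_ext; simpl;
    rewrite !Rplus_opp_r, exp_0, ?cos_0, ?sin_0; ring.
Qed.

Lemma Ccosh_double (z h : Cplx) :
  z = (h + h)%Cx -> (#2 * Ccosh z)%Cx = (Cexp h ^ 2 + Cexp (- h) ^ 2)%Cx.
Proof.
  intros ->; unfold Ccosh.
  replace (- (h + h))%Cx with (- h + - h)%Cx by ring.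
  rewrite !Cexp_add; apply Cplx_ext; simpl; field.
Qed.

(** Unlike [Minv], polynomial in the entries, so that words in such matrices stay within reach of
    [ring]. *)
Definition Madj (X : Mat2) : Mat2 := mkM (m22 X) (- m12 X)%Cx (- m21 X)%Cx (m11 X).

Ltac Mring := simpl; f_equal; ring.

Lemma Mmul_assoc (X Y Z : Mat2) : Mmul X (Mmul Y Z) = Mmul (Mmul X Y) Z.
Proof. destruct X, Y, Z; unfold Mmul; Mring. Qed.

Lemma Mmul_1l (X : Mat2) : Mmul MI X = X.
Proof. destruct X; unfold Mmul, MI; Mring. Qed.

Lemma Mdet_mul (X Y : Mat2) : Mdet (Mmul X Y) = (Mdet X * Mdet Y)%Cx.
Proof. destruct X, Y; unfold Mdet, Mmul; simpl; ring. Qed.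

Lemma Mdet_adj (X : Mat2) : Mdet (Madj X) = Mdet X.
Proof. destruct X; unfold Mdet, Madj; simpl; ring. Qed.

Lemma Minv_adj (X : Mat2) : Mdet X = C1 -> Minv X = Madj X.
Proof.
  intros h; unfold Minv; rewrite h.
  replace (Cinv C1) with C1 by (apply Cplx_ext; simpl; field).
  unfold Madj; Mring.
Qed.

Lemma Mmul_adjr (X : Mat2) : Mdet X = C1 -> Mmul X (Madj X) = MI.
Proof.
  destruct X as [a b c d]; unfold Mdet, Mmul, Madj, MI; simpl; intros <-.
  f_equal; ring.
Qed.

Lemma Mmul_adjl (X : Mat2) : Mdet X = C1 -> Mmul (Madj X) X = MI.
Proof.
  destruct X as [a b c d]; unfold Mdet, Mmul, Madj, MI; simpl; intros <-.
  f_equal; ring.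
Qed.

Lemma Mcommutator_eq1 (X Y : Mat2) :
  Mdet X = C1 -> Mdet Y = C1 -> Mmul X Y = Mmul Y X ->
  Mmul X (Mmul Y (Mmul (Minv X) (Minv Y))) = MI.
Proof.
  intros hX hY h; rewrite (Minv_adj X hX), (Minv_adj Y hY).
  rewrite Mmul_assoc, h, <- Mmul_assoc, (Mmul_assoc X), (Mmul_adjr X hX).
  now rewrite Mmul_1l, Mmul_adjr.
Qed.

(** Both sides reduce to [U]; this removes the leading inverse from [W]. *)
Lemma Mcommute_adj_mul (X U : Mat2) :
  Mdet X = C1 -> Mmul X U = Mmul U X ->
  Mmul X (Mmul (Madj X) U) = Mmul (Mmul (Madj X) U) X.
Proof.
  intros hX h; rewrite <- (Mmul_assoc (Madj X)), <- h, !Mmul_assoc.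
  now rewrite Mmul_adjr, Mmul_adjl.
Qed.

(** With equal diagonal entries [c], the terms in [c] cancel from the difference of the two
    products: up to sign its diagonal entries are [q U12 - p U21], and the others are multiples of
    [U11 - U22]. *)
Lemma Mcommute_const_diag (c p q : Cplx) (U : Mat2) :
  (m11 U - m22 U)%Cx = C0 -> (q * m12 U - p * m21 U)%Cx = C0 ->
  Mmul (mkM c p q c) U = Mmul U (mkM c p q c).
Proof.
  destruct U as [a b d e]; unfold Mmul; simpl; intros h1 h2.
  assert (h1' : a = e) by (replace a with (a - e + e)%Cx by ring; rewrite h1; ring).
  assert (h2' : (q * b = p * d)%Cx)
    by (replace (q * b)%Cx with (q * b - p * d + p * d)%Cx by ring; rewrite h2; ring).
  subst e; f_equal; ring [h2'].
Qed.

Definition commutator_word (X Y : Mat2) : Mat2 :=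
  let c1 := Mmul X (Mmul Y (Mmul (Madj X) (Madj Y))) in
  let c2 := Mmul X (Mmul (Madj Y) (Mmul (Madj X) Y)) in
  Mmul (Mmul c1 c1) (Mmul c2 c2).

Lemma Mdet_commutator_word (X Y : Mat2) :
  Mdet X = C1 -> Mdet Y = C1 -> Mdet (commutator_word X Y) = C1.
Proof.
  intros hX hY; unfold commutator_word; rewrite !Mdet_mul, !Mdet_adj, hX, hY; ring.
Qed.

Lemma Wmat_adj (X Y : Mat2) :
  Mdet X = C1 -> Mdet Y = C1 -> Wmat X Y = Mmul (Madj X) (commutator_word X Y).
Proof. intros hX hY; unfold Wmat; now rewrite (Minv_adj X hX), (Minv_adj Y hY). Qed.

(* Four times the homogenization of [RMpoly], in the variables [c = A s],
   [t = s^2] and [x = - 2 s^2 V]; the factor 4 clears the denominators that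
   [V = - x / (2 t)] introduces. *)
Definition RMhom (c t x : Cplx) : Cplx :=
  (- x ^ 5 + #2 * c ^ 2 * x ^ 4
   - (#4 * c ^ 4 + #8 * c ^ 2 * t - #4 * t ^ 2) * x ^ 3
   + (#4 * c ^ 6 + #8 * c ^ 4 * t - #12 * c ^ 2 * t ^ 2) * x ^ 2
   - #2 * (c ^ 8 + #4 * c ^ 6 * t - #2 * c ^ 4 * t ^ 2 - #12 * c ^ 2 * t ^ 3 + t ^ 4) * x
   - #16 * c ^ 6 * t ^ 2 - #32 * c ^ 4 * t ^ 3 + #16 * c ^ 2 * t ^ 4)%Cx.

(** With weights 1, 2, 2 on [c], [t], [x], every monomial of [RMhom] has weight 10, whence the
    factor [s ^ 10]. *)
Lemma RMhom_RMpoly (V : Cplx) (A : R) (s : Cplx) :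
  RMhom (#A * s) (s ^ 2) (- (s ^ 2 * (#2 * V))) = (#4 * s ^ 10 * RMpoly V A)%Cx.
Proof. unfold RMhom, RMpoly; ring. Qed.

(** The quotient, of degree 6, of [U11 - U22] by [RMhom]. It is divisible by [p ^ 2 - q ^ 2], in
    keeping with the fact that for [q = p] or [q = - p] the two matrices commute and [U] is
    scalar. *)
Definition RMcofactor (c p q : Cplx) : Cplx :=
  (q ^ 6 - p ^ 6
   + (p ^ 2 * q ^ 2 + #4 * c ^ 2 * p * q - #2 * c ^ 4) * (p ^ 2 - q ^ 2))%Cx.

Lemma commutator_word_diag (c p q : Cplx) :
  let U := commutator_word (mkM c p q c) (mkM c q p c) in
  (m11 U - m22 U)%Cx = (RMcofactor c p q * RMhom c (- (p * q)) (p ^ 2 + q ^ 2))%Cx.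
Proof.
  unfold commutator_word, Mmul, Madj, RMcofactor, RMhom.
  cbn [m11 m12 m21 m22]; ring.
Qed.

Lemma commutator_word_offdiag (c p q : Cplx) :
  let U := commutator_word (mkM c p q c) (mkM c q p c) in
  (q * m12 U - p * m21 U)%Cx =
  (- (c * RMcofactor c p q) * RMhom c (- (p * q)) (p ^ 2 + q ^ 2))%Cx.
Proof.
  unfold commutator_word, Mmul, Madj, RMcofactor, RMhom.
  cbn [m11 m12 m21 m22]; ring.
Qed.

Theorem theorem3p2 (alpha : R) (rho : Cplx) :
  0 < alpha < 2 * PI ->
  RMpoly (Ccosh rho) (cos (alpha / 2) / sin (alpha / 2)) = C0 ->
  let S := Smat alpha rho in
  let T := Tmat alpha rho in
  let W := Wmat S T in
  Mmul S (Mmul W (Mmul (Minv S) (Minv W))) = MI.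
Proof.
  intros halpha hP; cbv zeta; unfold Smat, Tmat.
  assert (hs : sin (alpha / 2) <> 0)
    by (apply Rgt_not_eq, sin_gt_0; lra).
  set (h := (#(/ 2) * rho)%Cx).
  assert (hh : rho = (h + h)%Cx) by (apply Cplx_ext; simpl; field).
  pose proof (Ccosh_double rho h hh) as hV.
  pose proof (Cexp_oppr h) as hEF.
  set (E := Cexp h) in *; set (F := Cexp (- h)%Cx) in *.
  set (s := RtoC (sin (alpha / 2))); set (c := RtoC (cos (alpha / 2))).
  set (p := (Ci * (E * s))%Cx); set (q := (Ci * (F * s))%Cx).
  (* [ring] sees [Ci], [E] and [F] as atoms; the relations [hi] and [hEF] are applied by rewriting
     in suitably grouped products. *)
  assert (hi : (Ci * Ci = #(-1))%Cx) by (apply Cplx_ext; simpl; ring).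
  assert (hpq : (s ^ 2)%Cx = (- (p * q))%Cx).
  { transitivity (- (Ci * Ci * (E * F) * s ^ 2))%Cx;
      [rewrite hi, hEF | unfold p, q]; ring. }
  assert (hx : (- (s ^ 2 * (#2 * Ccosh rho)))%Cx = (p ^ 2 + q ^ 2)%Cx).
  { rewrite hV; transitivity (Ci * Ci * (E ^ 2 + F ^ 2) * s ^ 2)%Cx;
      [rewrite hi | unfold p, q]; ring. }
  assert (hc : c = (#(cos (alpha / 2) / sin (alpha / 2)) * s)%Cx)
    by (apply Cplx_ext; simpl; now field).
  (* Back in the variables [s], [A], [V], this value is [4 s^10 P(V,A)], which vanishes by [hP]. *)
  assert (hQ : RMhom c (- (p * q)) (p ^ 2 + q ^ 2) = C0).
  { rewrite <- hpq, <- hx, hc, RMhom_RMpoly, hP; ring. }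
  (* Since [- p q = s ^ 2], this is the identity between squared sine and cosine. *)
  assert (hdet : (c * c - p * q)%Cx = C1).
  { replace (p * q)%Cx with (- (s ^ 2))%Cx by (rewrite hpq; ring).
    apply Cplx_ext; simpl; [|ring].
    pose proof (sin2_cos2 (alpha / 2)) as h1; unfold Rsqr in h1; lra. }
  assert (hS : Mdet (mkM c p q c) = C1) by exact hdet.
  assert (hT : Mdet (mkM c q p c) = C1)
    by (unfold Mdet; simpl; rewrite <- hdet; ring).
  rewrite (Wmat_adj _ _ hS hT).
  apply Mcommutator_eq1; [exact hS | |].
  - rewrite Mdet_mul, Mdet_adj, hS, Mdet_commutator_word by assumption; ring.
  - apply Mcommute_adj_mul; [exact hS|].
    apply Mcommute_const_diag;
      rewrite ?commutator_word_diag, ?commutator_word_offdiag, hQ; ring.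
Qed.
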